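(* The zero duality gap property $$\sup_{\lambda \ge 0} \inf_{(x, p) \in A \times P} F_{\lambda}(x, p) = \inf_{x \in \Omega} f(x)$$ holds true for the parametric penalty function $F_{\lambda}$ if and only if $F_{\lambda}$ is bounded below on $A \times P$ for some $\lambda \ge 0$ and the perturbation function $\beta \colon [0,+\infty) \to [-\infty,+\infty]$, $\beta(\eta) = \inf_{x \in \Omega(\eta)} f(x)$, where $\Omega(\eta) = \{ x \in A \mid \inf_{p \in P} \varphi(x, p) \le \eta \}$, is lower semicontinuous at the origin.
   Context: Setting. $X$ and $P$ are metric spaces, $M, A \subset X$ are nonempty, $f \colon X \to \mathbb{R} \cup \{+\infty\}$. The problem $(\mathcal{P})$ is: minimize $f(x)$ subject to $x \in M$, $x \in A$. $\Omega = M \cap A$; it is assumed that $f$ attains a global minimum on $\Omega$, with finite value $f^*$. $p_0 \in P$ is fixed, and $\varphi \colon X \times P \to [0, +\infty]$ satisfies $\varphi(x, p) = 0$ iff $p = p_0$ and $x \in M$. The parametric penalty function is $F_{\lambda}(x, p) = f(x) + \lambda \varphi(x, p)$, $\lambda \ge 0$. By the paper's convention $\beta(0) = f^*$, i.e. the value of the perturbation function at the origin is the optimal value of $(\mathcal{P})$; lower semicontinuity of $\beta$ at the origin thus means $\liminf_{\eta \to +0} \beta(\eta) \ge f^*$. *)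

(* Defs.v *)
From HB Require Import structures.
From mathcomp Require Import all_boot all_order all_algebra.
From mathcomp Require Import all_classical all_reals all_analysis.

Set Implicit Arguments.
Unset Strict Implicit.
Unset Printing Implicit Defensive.

Import Order.TTheory GRing.Theory Num.Theory.
Import numFieldNormedType.Exports.

Local Open Scope classical_set_scope.
Local Open Scope ring_scope.
Local Open Scope ereal_scope.

Definition optimal_value (R : realType) (X : Type) (f : X -> \bar R)
    (M A : set X) : \bar R :=
  ereal_inf (f @` (M `&` A)).

(* In \bar R one has 0 * +oo = 0, so the penalty function for lam = 0 is f.
   The sum is never of the form -oo + +oo as soon as f avoids -oo and
   phi and lam are nonnegative. *)
Definition penalty (R : realType) (X P : Type) (f : X -> \bar R)
    (phi : X * P -> \bar R) (lam : R) (z : X * P) : \bar R :=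
  f z.1 + lam%:E * phi z.

Definition bounded_below_on (R : realType) (T : Type) (g : T -> \bar R)
    (D : set T) : Prop :=
  exists c : R, forall z, D z -> c%:E <= g z.

Definition zero_duality_gap (R : realType) (X P : Type) (f : X -> \bar R)
    (phi : X * P -> \bar R) (M A : set X) : Prop :=
  ereal_sup [set ereal_inf (penalty f phi lam @` (A `*` [set: P]))
            | lam in [set lam : R | (0 <= lam)%R]]
  = optimal_value f M A.

Definition perturbed_set (R : realType) (X P : Type)
    (phi : X * P -> \bar R) (A : set X) (eta : R) : set X :=
  [set x | A x /\ ereal_inf [set phi (x, p) | p in [set: P]] <= eta%:E].

(* The value at 0 is the optimal value by convention: the infimum over p need
   not be attained, so perturbed_set phi A 0 may be strictly larger than
   M `&` A.  Only eta >= 0 is meaningful. *)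
Definition perturbation (R : realType) (X P : Type) (f : X -> \bar R)
    (phi : X * P -> \bar R) (M A : set X) (eta : R) : \bar R :=
  if eta == 0%R then optimal_value f M A
  else ereal_inf (f @` perturbed_set phi A eta).

(* Lower semicontinuity at 0 of a function on [0, +oo[, hence the one-sided
   filter. *)
Definition lsc_at_origin (R : realType) (g : R -> \bar R) : Prop :=
  g 0%R <= limf_einf g (0%R : R)^'+.

(* Main.v *)
(* Two comparisons between the perturbed problem and the penalty functions.
   For eta > 0, a point x of Omega(eta) has some p with phi (x, p) < 2 eta, so
   f x and F_lam (x, p) differ by at most 2 lam eta: a lower bound for F_lam
   yields, up to e, the same lower bound for f on Omega(eta), eta small.
   Conversely, a lower bound for f on Omega(eta) passes to F_lam at points with
   phi <= eta, and at points with phi > eta one has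
   F_lam >= F_lam0 + (lam - lam0) * eta, which is large with lam because F_lam0
   is bounded below. *)

Require Import Defs.
From HB Require Import structures.
From mathcomp Require Import all_boot all_order all_algebra.
From mathcomp Require Import all_classical all_reals all_analysis.

Import Order.TTheory GRing.Theory Num.Theory.
Import numFieldNormedType.Exports.

Local Open Scope classical_set_scope.
Local Open Scope ring_scope.
Local Open Scope ereal_scope.

(** [perturbed_set] grows with [eta], so a lower bound for [f] on it at one [eta] persists at all
    smaller positive ones; hence a single [eta] for each [e] captures the lower limit. *)
Lemma lsc_perturbationP (R : realType) (X P : Type) (f : X -> \bar R)
    (phi : X * P -> \bar R) (M A : set X) (v : R) :
  optimal_value f M A = v%:E ->
  lsc_at_origin (perturbation f phi M A) <->
  forall e : R, (0 < e)%R -> exists2 eta : R, (0 < eta)%R &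
    forall x, perturbed_set phi A eta x -> (v - e)%:E <= f x.
Proof.
move=> vE; rewrite /lsc_at_origin limf_einfE {1}/perturbation eqxx vE; split.
  move=> vle e e0.
  have vlt : (v - e)%:E < v%:E by rewrite lte_fin ltrBlDr ltrDl.
  have /ereal_sup_gt[_ [V V0 <-] veV] := lt_le_trans vlt vle.
  (* A positive point of [V] escapes the convention at 0: there [perturbation] is the infimum over
     the perturbed set. *)
  have Vpos : \forall y \near (0%R : R)^'+, V y /\ (0 < y)%R.
    by apply: filterI => //; exact: nbhs_right_gt.
  have [eta [Veta eta0]] := filter_ex Vpos; exists eta => // x xeta.
  apply: (le_trans (ltW veV)).
  apply: (@le_trans _ _ (perturbation f phi M A eta)).
    by apply: ereal_inf_lbound; exists eta.
  by rewrite /perturbation gt_eqF//; apply: ereal_inf_lbound; exists x.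
move=> H; apply/lee_subgt0Pr => e /H[eta eta0 veta]; rewrite -EFinB.
apply: (@le_trans _ _ (ereal_inf (perturbation f phi M A @`
    [set y | (0 < y < eta)%R]))); last first.
  apply: ereal_sup_ubound; exists [set y | (0 < y < eta)%R] => //.
  near=> y; apply/andP; split; near: y;
    [exact: nbhs_right_gt | exact: nbhs_right_lt].
apply/ereal_infP => _ [y /= /andP[y0 yeta] <-].
rewrite /perturbation gt_eqF//; apply/ereal_infP => _ [x [Ax xy] <-].
by apply: veta; split => //; apply: (le_trans xy); rewrite lee_fin ltW.
Unshelve. all: by end_near. Qed.

(** Weak duality is automatic: each penalty function takes the value [v] at [(xs, p0)], so its
    infimum over [A] and all [p] never exceeds [v]. Only the approximation of [v] from below remains
    as a condition. *)
Lemma zero_duality_gapP (R : realType) (X P : Type) (f : X -> \bar R)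
    (phi : X * P -> \bar R) (M A : set X) (v : R) (xs : X) (p0 : P) :
  optimal_value f M A = v%:E -> A xs -> f xs = v%:E -> phi (xs, p0) = 0 ->
  zero_duality_gap f phi M A <->
  forall e : R, (0 < e)%R -> exists2 lam : R, (0 <= lam)%R &
    forall z, A z.1 -> (v - e)%:E <= penalty f phi lam z.
Proof.
move=> vE Axs fxs phi0; rewrite /zero_duality_gap vE; split.
  move=> supE e e0; have [|_ [lam lam0 <-] velam] := @ereal_sup_gt _
      [set ereal_inf (penalty f phi lam @` (A `*` [set: P]))
      | lam in [set lam : R | (0 <= lam)%R]] (v - e)%:E _.
    by rewrite supE lte_fin ltrBlDr ltrDl.
  exists lam => // z Az; apply: (le_trans (ltW velam)).
  by apply: ereal_inf_lbound; exists z.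
move=> H; apply/eqP; rewrite eq_le; apply/andP; split.
  apply/ereal_supP => _ [lam _ <-]; apply: ereal_inf_lbound.
  by exists (xs, p0) => //; rewrite /penalty fxs phi0 mule0 adde0.
apply/lee_subgt0Pr => e /H[lam lam0 velam]; rewrite -EFinB.
apply: (@le_trans _ _ (ereal_inf (penalty f phi lam @` (A `*` [set: P])))).
  by apply/ereal_infP => _ [z [Az _] <-]; exact: velam.
by apply: ereal_sup_ubound; exists lam.
Qed.

Lemma perturbed_set_ge (R : realType) (X P : Type) (f : X -> \bar R)
    (phi : X * P -> \bar R) (A : set X) (lam a e : R) :
  (0 <= lam)%R -> (0 < e)%R ->
  (forall z, A z.1 -> a%:E <= penalty f phi lam z) ->
  exists2 eta : R, (0 < eta)%R &
    forall x, perturbed_set phi A eta x -> (a - e)%:E <= f x.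
Proof.
move=> lam0 e0 alam; have lam1 : (0 < lam + 1)%R by rewrite ltr_wpDl.
have d0 : (0 < e / (lam + 1))%R by rewrite divr_gt0.
(* The infimum over [p] need not be attained; halving makes it strictly less than [e / (lam + 1)],
   so some [p] has [phi] below that. The [+ 1] covers [lam = 0] and still gives
   [lam * e / (lam + 1) <= e]. *)
exists (e / (lam + 1) / 2)%R; first by rewrite divr_gt0.
move=> x [Ax xd].
have [|_ [p _ <-] phid] :=
    @ereal_inf_lt _ [set phi (x, p) | p in [set: P]] (e / (lam + 1))%:E _.
  by apply: le_lt_trans xd _; rewrite lte_fin ltr_pdivrMr// ltr_pMr// ltr1n.
have ale := alam (x, p) Ax.
rewrite EFinB leeBlDr//; apply: (le_trans ale); apply: leeD => //.
apply: (@le_trans _ _ (lam%:E * (e / (lam + 1))%:E)).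
  by apply: lee_wpmul2l; [rewrite lee_fin | exact: ltW].
by rewrite -EFinM lee_fin mulrA ler_pdivrMr// mulrC ler_pM2l// lerDl.
Qed.

Lemma penalty_ge (R : realType) (X P : Type) (f : X -> \bar R)
    (phi : X * P -> \bar R) (A : set X) (lam0 eta a c : R) :
  (forall z, 0 <= phi z) -> (0 <= lam0)%R -> (0 < eta)%R ->
  (forall z, A z.1 -> c%:E <= penalty f phi lam0 z) ->
  (forall x, perturbed_set phi A eta x -> a%:E <= f x) ->
  exists2 lam : R, (0 <= lam)%R &
    forall z, A z.1 -> a%:E <= penalty f phi lam z.
Proof.
(* [t] is chosen so that [c + t * eta = c + |a - c| >= a]; the absolute value keeps it
   nonnegative. *)
move=> phi0 lam00 eta0 cle ale; pose t := (`|a - c| / eta)%R.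
have t0 : (0 <= t)%R by rewrite divr_ge0// ltW.
exists (lam0 + t)%R; first exact: addr_ge0.
move=> [x p] Ax; have [phile|phigt] := leP (phi (x, p)) eta%:E.
  apply: (@le_trans _ _ (f x)).
    apply: ale; split => //.
    by apply: ge_ereal_inf; exists (phi (x, p)); first exists p.
  by rewrite /penalty leeDl// mule_ge0// lee_fin addr_ge0.
(* Split off the penalty function at [lam0], which is at least [c]; the extra weight [t] multiplies
   a value of [phi] above [eta]. *)
rewrite /penalty EFinD ge0_muleDl ?lee_fin// addeA.
apply: (@le_trans _ _ (c%:E + t%:E * eta%:E)); last first.
  apply: leeD; first exact: cle.
  by apply: lee_wpmul2l; [rewrite lee_fin | exact: ltW].
by rewrite -EFinM -EFinD lee_fin divfK ?gt_eqF// -lerBlDl ler_norm.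
Qed.

Theorem theorem3p16 (R : realType) (X P : metricType R) (M A : set X)
    (f : X -> \bar R) (p0 : P) (phi : X * P -> \bar R)
    (M_nonempty : M !=set0) (A_nonempty : A !=set0)
    (f_neq_ninfty : forall x : X, f x != -oo)
    (f_attains_min : exists xs : X, [/\ (M `&` A) xs, f xs \is a fin_num &
       forall x : X, (M `&` A) x -> f xs <= f x])
    (phi_ge0 : forall z : X * P, 0 <= phi z)
    (phi_eq0 : forall (x : X) (p : P), phi (x, p) = 0 <-> p = p0 /\ M x) :
  zero_duality_gap f phi M A <->
  (exists lam : R, (0 <= lam)%R /\
     bounded_below_on (penalty f phi lam) (A `*` [set: P])) /\
  lsc_at_origin (perturbation f phi M A).
Proof.
have [xs [[Mxs Axs] fxs fmin]] := f_attains_min.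
have vE : optimal_value f M A = (fine (f xs))%:E.
  rewrite fineK//; apply/eqP; rewrite eq_le; apply/andP; split.
    by apply: ereal_inf_lbound; exists xs.
  by apply/ereal_infP => _ [x MAx <-]; exact: fmin.
have phixs : phi (xs, p0) = 0 by apply/phi_eq0.
rewrite (zero_duality_gapP _ _ _ _ _ _ _ _ _ _ vE Axs (esym (fineK fxs)) phixs).
rewrite (lsc_perturbationP _ _ _ _ phi _ _ _ vE); split.
  move=> H; split.
    have [lam lam0 vlam] := H 1%R ltr01.
    by exists lam; split => //; exists (fine (f xs) - 1)%R => z [Az _]; exact: vlam.
  (* One half of [e] is spent on approximating the optimal value by a penalty function, the other on
     passing from that function to [f]. *)
  move=> e e0; have e20 : (0 < e / 2)%R by rewrite divr_gt0.
  have [lam lam0 vlam] := H _ e20.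
  have [eta eta0 veta] := perturbed_set_ge _ _ _ _ _ _ _ _ _ lam0 e20 vlam.
  by exists eta => // x /veta; rewrite -addrA -opprD -splitr.
move=> [[lam [lam0 [c clam]]] H] e /H[eta eta0 veta].
apply: (penalty_ge _ _ _ _ _ _ lam eta _ c phi_ge0 lam0 eta0 _ veta) => z Az.
exact: clam.
Qed.
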